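(* Let $\mathcal{Q}_0=\left(\frac{(x+4)/x,\;z(z-x)}{\mathbb{R}(x,z)}\right)$. Let $\mathcal{V}_0$ be the set of elements of $\mathcal{Q}_0$ of norm $1$ of the form $r(x,z)+s(x,z)\mathbf{i}+t(x,z)\mathbf{j}+w(x,z)\mathbf{k}$, where $$2r,\,2s,\,2t,\,2w\in\mathbb{Z}[x,z],\qquad r(0,0)=1,\qquad s(x,z)\equiv z\,w(x,z)\pmod x .$$ Then $\mathcal{V}_0$ is a group (under multiplication). This group is not trivial; for instance $$\Big\{\tfrac12\big(x+2+x\mathbf{i}\big),\ \tfrac12\big(x+2+(x-2z)\mathbf{i}-2\mathbf{k}\big),\ \tfrac12\big(z+2-z\mathbf{i}-\mathbf{j}-\mathbf{k}\big)\Big\}\subset\mathcal{V}_0 .$$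
   Context: For a field $F$ of characteristic $\neq2$ and nonzero $a,b\in F$, $\left(\frac{a,b}{F}\right)$ is the quaternion algebra with $F$-basis $1,\mathbf{i},\mathbf{j},\mathbf{k}$, $\mathbf{i}^2=a$, $\mathbf{j}^2=b$, $\mathbf{i}\mathbf{j}=-\mathbf{j}\mathbf{i}=\mathbf{k}$. The norm of $n_0+n_1\mathbf{i}+n_2\mathbf{j}+n_3\mathbf{k}$ is $n_0^2-an_1^2-bn_2^2+abn_3^2$. Here $x,z$ are indeterminates and $\mathbb{R}(x,z)$ is the field of rational functions. The congruence modulo $x$ means that $(s-zw)/x$ is a polynomial. *)

(* Defs.v *)
From HB Require Import structures.
From mathcomp Require Import all_boot all_order all_algebra.
From mathcomp Require Import polyXY fraction ring reals.

Set Implicit Arguments.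
Unset Strict Implicit.
Unset Printing Implicit Defensive.

Import GRing.Theory Num.Theory.
Local Open Scope ring_scope.

(* [quaternion a b] is the quaternion algebra (a, b / F): [Quat r s t w] stands
   for r + s i + t j + w k.  The standing hypotheses char F <> 2, a != 0 and
   b != 0 are not needed to define the algebra; they are proved below for the
   algebra Q0. *)
Record quaternion (F : fieldType) (a b : F) := Quat {
  qre : F;
  qi : F;
  qj : F;
  qk : F
}.
Arguments Quat {F a b}.

Section QuaternionAlgebra.
Variables (F : fieldType) (a b : F).
Local Notation Q := (quaternion a b).
Implicit Types p q u : Q.

Definition quat_to_prod q := (qre q, qi q, qj q, qk q).
Definition prod_to_quat (v : F * F * F * F) : Q :=
  let: (r, s, t, w) := v in Quat r s t w.
Lemma quat_to_prodK : cancel quat_to_prod prod_to_quat.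
Proof. by case. Qed.

HB.instance Definition _ := Choice.copy Q (can_type quat_to_prodK).

Definition qzero : Q := Quat 0 0 0 0.
Definition qone : Q := Quat 1 0 0 0.
Definition qopp q : Q := Quat (- qre q) (- qi q) (- qj q) (- qk q).
Definition qadd p q : Q :=
  Quat (qre p + qre q) (qi p + qi q) (qj p + qj q) (qk p + qk q).
Definition qscale (c : F) q : Q :=
  Quat (c * qre q) (c * qi q) (c * qj q) (c * qk q).

(* The bilinear extension of i^2 = a, j^2 = b, ij = -ji = k, whence k^2 = -ab,
   ik = -ki = aj and kj = -jk = bi. *)
Definition qmul p q : Q :=
  Quat (qre p * qre q + a * (qi p * qi q) + b * (qj p * qj q)
          - a * b * (qk p * qk q))
       (qre p * qi q + qi p * qre q - b * (qj p * qk q) + b * (qk p * qj q))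
       (qre p * qj q + qj p * qre q + a * (qi p * qk q) - a * (qk p * qi q))
       (qre p * qk q + qk p * qre q + qi p * qj q - qj p * qi q).

Fact qaddA : associative qadd.
Proof. by move=> p q u; rewrite /qadd /= !addrA. Qed.
Fact qaddC : commutative qadd.
Proof. by move=> p q; congr Quat; rewrite addrC. Qed.
Fact qadd0 : left_id qzero qadd.
Proof. by case=> r s t w; rewrite /qadd /= !add0r. Qed.
Fact qaddN : left_inverse qzero qopp qadd.
Proof. by move=> q; rewrite /qadd /= !addNr. Qed.
HB.instance Definition _ := GRing.isZmodule.Build Q qaddA qaddC qadd0 qaddN.

Fact qmulA : associative qmul.
Proof. by move=> p q u; congr Quat; rewrite /=; ring. Qed.
Fact qmul1l : left_id qone qmul.
Proof. by case=> r s t w; congr Quat; rewrite /=; ring. Qed.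
Fact qmul1r : right_id qone qmul.
Proof. by case=> r s t w; congr Quat; rewrite /=; ring. Qed.
Fact qmulDl : left_distributive qmul +%R.
Proof. by move=> p q u; congr Quat; rewrite /=; ring. Qed.
Fact qmulDr : right_distributive qmul +%R.
Proof. by move=> p q u; congr Quat; rewrite /=; ring. Qed.
Fact qone_neq0 : qone != 0.
Proof. by apply/eqP => -[] /eqP; rewrite oner_eq0. Qed.
HB.instance Definition _ := GRing.Zmodule_isNzRing.Build Q
  qmulA qmul1l qmul1r qmulDl qmulDr qone_neq0.

Fact qscaleA c d q : qscale c (qscale d q) = qscale (c * d) q.
Proof. by congr Quat; rewrite /= mulrA. Qed.
Fact qscale1 : left_id 1 qscale.
Proof. by case=> r s t w; rewrite /qscale /= !mul1r. Qed.
Fact qscaleDr : right_distributive qscale +%R.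
Proof. by move=> c p q; congr Quat; rewrite /= mulrDr. Qed.
Fact qscaleDl q : {morph qscale^~ q : c d / c + d}.
Proof. by move=> c d; congr Quat; rewrite /= mulrDl. Qed.
HB.instance Definition _ := GRing.Zmodule_isLmodule.Build F Q
  qscaleA qscale1 qscaleDr qscaleDl.

Fact qscaleAl c p q : c *: (p * q) = (c *: p) * q.
Proof. by congr Quat; rewrite /=; ring. Qed.
HB.instance Definition _ := GRing.Lmodule_isLalgebra.Build F Q qscaleAl.
Fact qscaleAr c p q : c *: (p * q) = p * (c *: q).
Proof. by congr Quat; rewrite /=; ring. Qed.
HB.instance Definition _ := GRing.Lalgebra_isAlgebra.Build F Q qscaleAr.

Definition quat_i : Q := Quat 0 1 0 0.
Definition quat_j : Q := Quat 0 0 1 0.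
Definition quat_k : Q := Quat 0 0 0 1.

Lemma quat_basis (r s t w : F) :
  r%:A + s *: quat_i + t *: quat_j + w *: quat_k = Quat r s t w.
Proof. by congr Quat; rewrite /=; ring. Qed.

Lemma quat_ii : quat_i * quat_i = a%:A.
Proof. by congr Quat; rewrite /=; ring. Qed.
Lemma quat_jj : quat_j * quat_j = b%:A.
Proof. by congr Quat; rewrite /=; ring. Qed.
Lemma quat_ij : quat_i * quat_j = quat_k.
Proof. by congr Quat; rewrite /=; ring. Qed.
Lemma quat_ji : quat_j * quat_i = - quat_k.
Proof. by congr Quat; rewrite /=; ring. Qed.

Definition qnorm q : F :=
  qre q ^+ 2 - a * qi q ^+ 2 - b * qj q ^+ 2 + a * b * qk q ^+ 2.

End QuaternionAlgebra.

(* Associativity is inherited from the ring A. *)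
Definition is_mul_group (A : nzRingType) (V : A -> Prop) : Prop :=
  [/\ V 1,
      forall p q, V p -> V q -> V (p * q)
    & forall p, V p -> exists2 q, V q & p * q = 1 /\ q * p = 1].

Section V0.
Local Notation "p %:F" := (tofrac p) : ring_scope.
Variable R : realType.

(* R[x, z] is represented as in polyXY: x is the outer indeterminate 'X, z is
   the inner one 'Y, and p.[u, v] is p evaluated at x = u, z = v. *)
Definition ratfun : fieldType := {fraction {poly {poly R}}}.

Definition X : ratfun := ('X : {poly {poly R}})%:F.
Definition Z : ratfun := ('Y : {poly {poly R}})%:F.

Definition a0 : ratfun := (X + 4) / X.
Definition b0 : ratfun := Z * (Z - X).
Definition Q0 : algType ratfun := quaternion a0 b0.

Lemma ratfun_2_neq0 : (2 : ratfun) != 0.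
Proof.
rewrite -(rmorph_nat (@tofrac _)) tofrac_eq0 -!polyC_natr !polyC_eq0.
by rewrite pnatr_eq0.
Qed.

Lemma a0_neq0 : a0 != 0.
Proof.
rewrite mulf_eq0 invr_eq0 negb_or !tofrac_eq0 polyX_eq0 andbT.
rewrite -(rmorph_nat (@tofrac _)) -rmorphD tofrac_eq0 -polyC_natr.
by rewrite -[_ + _]/('X + (4%:R)%:P) -size_poly_eq0 size_XaddC.
Qed.

Lemma b0_neq0 : b0 != 0.
Proof.
rewrite mulf_eq0 negb_or tofrac_eq0 polyC_eq0 polyX_eq0 /=.
by rewrite -rmorphB tofrac_eq0 -opprB oppr_eq0 polyXsubC_eq0.
Qed.

Definition int_coef (p : {poly {poly R}}) : Prop :=
  exists P : {poly {poly int}}, p = map_poly (map_poly intr) P.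

Definition V0 (q : Q0) : Prop :=
  qnorm q = 1 /\
  exists r s t w : {poly {poly R}},
    [/\ q = r%:F%:A + s%:F *: quat_i a0 b0 + t%:F *: quat_j a0 b0
              + w%:F *: quat_k a0 b0,
        [/\ int_coef (2 * r), int_coef (2 * s), int_coef (2 * t)
          & int_coef (2 * w)],
        r.[0, 0] = 1
      & exists p : {poly {poly R}}, (s%:F - Z * w%:F) / X = p%:F].

End V0.

(* Main.v *)
Require Import Defs.
From mathcomp Require Import all_boot all_order all_algebra.
From mathcomp Require Import reals.
From HB Require Import structures.
From mathcomp Require Import polyXY fraction ring.

Set Implicit Arguments.
Unset Strict Implicit.
Unset Printing Implicit Defensive.

Import GRing.Theory Num.Theory.

Local Open Scope ring_scope.

(** The half-integral elements of [Q0] with [s = z w] modulo [x] are not closed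
    under multiplication: denominators grow from 2 to 4.  The point is that
    norm 1 forces parities that rule this out.  Write such an element as
    [(r + s i + t j + w k) / 2] with [r, s, t, w] in Z[x,z] and
    [s = z w + x p].  Clearing denominators, norm 1 reads
      [r^2 = 4 + (x+4) (x p^2 + 2 z w p + z w^2) + z (z-x) t^2],
    where the congruence on [s] has cancelled the denominator of
    [a = (x+4)/x].  Modulo 2 this becomes
      [(r + x p + z t)^2 = x z (t + w)^2],
    and [x z] is not a square in F_2(x,z), so both sides vanish:
    [r = x p + z t] and [w = t] modulo 2 ([norm_eq_parity]).

    So every element of [V0] lies in the free Z[x,z]-module with basis
      [1], [x (1+i) / 2], [(z (1+i) + j + k) / 2], [z i + k].
    Writing [A, P, T, B] for the coordinates, this module is a subring stable
    under conjugation ([order_mul], [order_conj]), and [r(0,0)/2 = A(0,0)] is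
    multiplicative since the [A]-coordinate of a product is [A A'] modulo the
    ideal [(x, z)].  Hence [V0] consists exactly of the elements of norm 1 of
    this order with [A(0,0) = 1] ([V0P]); the norm being multiplicative, they
    form a group in which the inverse is the conjugate. *)

(** * Norm and conjugation *)

Lemma qnormM (F : fieldType) (a b : F) (p q : quaternion a b) :
  qnorm (p * q) = qnorm p * qnorm q.
Proof. by case: p q => [????] [????]; rewrite /qnorm /=; ring. Qed.

Definition qconj (F : fieldType) (a b : F) (q : quaternion a b) :
    quaternion a b :=
  Quat (qre q) (- qi q) (- qj q) (- qk q).

Lemma qnorm_conj (F : fieldType) (a b : F) (q : quaternion a b) :
  qnorm (qconj q) = qnorm q.
Proof. by rewrite /qnorm /= !sqrrN. Qed.

Lemma mul_qconj (F : fieldType) (a b : F) (q : quaternion a b) :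
  q * qconj q = (qnorm q)%:A.
Proof.
by case: q => r s t w; rewrite /qconj /qnorm /=; congr Quat => /=; ring.
Qed.

Lemma mul_conjq (F : fieldType) (a b : F) (q : quaternion a b) :
  qconj q * q = (qnorm q)%:A.
Proof.
by case: q => r s t w; rewrite /qconj /qnorm /=; congr Quat => /=; ring.
Qed.

(** * An order stable under multiplication and conjugation *)

Section ProductCoordinates.
Variables (K : comNzRingType) (x z A P T B A' P' T' B' : K).

(** The structure constants have coefficients in Z[x,z]; they are stated over any
   commutative ring, so that the multiplication computed in R(x,z) can be pulled
   back to polynomial coordinates along a ring morphism. *)
Definition coordA_mul : K :=
  A * A' + x * z * B * (P' + T' + B')
  - 2 * z * (P * B' - B * P') - z * (P * T' - T * P')
  + z * (T + 2 * B) * P' + z * P * (T' + 2 * B')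
  + x * P * P' + z * (T + 2 * B) * (T' + 2 * B').
Definition coordP_mul : K :=
  x * P * P' + z * T * P' + A * P' + P * A' + z * (T * B' - B * T').
Definition coordT_mul : K :=
  x * P * T' + z * T * T' + A * T' + T * A'
  + (x + 4) * (P * B' - B * P') + 2 * (P * T' - T * P').
Definition coordB_mul : K :=
  A * B' + B * A' + z * B * T' + x * B * P'
  - 2 * (P * B' - B * P') - (P * T' - T * P').

End ProductCoordinates.

Lemma rmorph_mulcoords (K L : comNzRingType) (f : {rmorphism K -> L})
    (x z A P T B A' P' T' B' : K) :
  let mapf g := f (g K x z A P T B A' P' T' B')
      = g L (f x) (f z) (f A) (f P) (f T) (f B) (f A') (f P') (f T') (f B') in
  [/\ mapf coordA_mul, mapf coordP_mul, mapf coordT_mul & mapf coordB_mul].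
Proof.
by split; rewrite /coordA_mul /coordP_mul /coordT_mul /coordB_mul
  !(rmorph_nat, rmorphB, rmorphD, rmorphM).
Qed.

Section Order.
Variables (F : fieldType) (x z : F).
Hypotheses (x_neq0 : x != 0) (two_neq0 : (2 : F) != 0).

Local Notation Q := (quaternion ((x + 4) / x) (z * (z - x))).

(** The combination of [1], [x (1+i) / 2], [(z (1+i) + j + k) / 2] and [z i + k]
    with coefficients [A], [P], [T], [B]. *)
Definition order_elt (A P T B : F) : Q :=
  Quat ((x * P + z * T + 2 * A) / 2) ((z * (T + 2 * B) + x * P) / 2)
    (T / 2) ((T + 2 * B) / 2).

(** The products of the four basis vectors have coordinates without any division
    by [x] or by 2, although [a = (x+4)/x] and the basis have denominators. *)
Lemma order_mul A P T B A' P' T' B' :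
  order_elt A P T B * order_elt A' P' T' B' =
  order_elt (coordA_mul x z A P T B A' P' T' B') (coordP_mul x z A P T B A' P' T' B')
    (coordT_mul x z A P T B A' P' T' B') (coordB_mul x z A P T B A' P' T' B').
Proof.
by congr Quat; rewrite /coordA_mul /coordP_mul /coordT_mul /coordB_mul /=;
  field; rewrite ?x_neq0 ?two_neq0.
Qed.

Lemma order_conj A P T B :
  qconj (order_elt A P T B) =
  order_elt (A + x * P + z * T) (- P) (- T) (- B).
Proof. by congr Quat; rewrite /=; field. Qed.

(** In [a s^2 - a b w^2 = a (s^2 - z (z-x) w^2)] with [s = z w + x p], the
    bracket is divisible by [x], which is the denominator of [a]. *)
Lemma qnorm_half (r p t w : F) :
  r ^+ 2 = 4 * qnorm (Quat (r / 2) ((z * w + x * p) / 2) (t / 2) (w / 2) : Q)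
  + (x + 4) * (x * p ^+ 2 + 2 * z * w * p + z * w ^+ 2)
  + z * (z - x) * t ^+ 2.
Proof. by rewrite /qnorm /=; field; rewrite x_neq0 two_neq0. Qed.

Lemma half_congr (w p : F) :
  ((z * w + x * p) / 2 - z * (w / 2)) / x = p / 2.
Proof. by field; rewrite x_neq0 two_neq0. Qed.

Let i : Q := quat_i _ _.
Let j : Q := quat_j _ _.
Let k : Q := quat_k _ _.

Lemma example1 :
  2^-1 *: ((x + 2)%:A + x *: i) = order_elt 1 1 0 0.
Proof. by congr Quat; rewrite /=; field. Qed.

Lemma example2 :
  2^-1 *: ((x + 2)%:A + (x - 2 * z) *: i - 2 *: k) = order_elt 1 1 0 (-1).
Proof. by congr Quat; rewrite /=; field. Qed.

Lemma example3 :
  2^-1 *: ((z + 2)%:A - z *: i - j - k) = order_elt (1 + z) 0 (-1) 0.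
Proof. by congr Quat; rewrite /=; field. Qed.

Lemma qnorm_example1 : qnorm (order_elt 1 1 0 0) = 1.
Proof. by rewrite /qnorm /=; field; rewrite x_neq0 two_neq0. Qed.

Lemma qnorm_example2 : qnorm (order_elt 1 1 0 (-1)) = 1.
Proof. by rewrite /qnorm /=; field; rewrite x_neq0 two_neq0. Qed.

Lemma qnorm_example3 : qnorm (order_elt (1 + z) 0 (-1) 0) = 1.
Proof. by rewrite /qnorm /=; field; rewrite x_neq0 two_neq0. Qed.

Lemma example1_neq1 : order_elt 1 1 0 0 <> 1.
Proof.
case=> _ /eqP; rewrite !(mulr0, add0r, mulr1) mulf_eq0 invr_eq0.
by rewrite (negPf x_neq0) (negPf two_neq0).
Qed.

End Order.

(** * Parity of the coefficients of an element of norm 1 *)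

(** [xz] is not a square in the fraction field: a nonzero square has even degree
    in [x], whereas [xz] times a square has odd degree. *)
Lemma sqr_eq_XYsqr (D : idomainType) (u v : {poly {poly D}}) :
  u ^+ 2 = 'X * 'Y * v ^+ 2 -> u = 0 /\ v = 0.
Proof.
have [->|v0] := eqVneq v 0.
  by rewrite expr0n /= mulr0 => /eqP; rewrite sqrf_eq0 => /eqP.
have Y0 : 'Y != 0 :> {poly {poly D}} by rewrite polyC_eq0 polyX_eq0.
have [->|u0] := eqVneq u 0.
  move/esym/eqP; rewrite expr0n /= mulf_eq0 sqrf_eq0 (negPf v0) orbF.
  by rewrite mulf_eq0 (negPf Y0) polyX_eq0.
move/(congr1 (fun p : {poly {poly D}} => odd (size p))).
have -> : 'X * 'Y * v ^+ 2 = 'Y * v ^+ 2 * 'X by ring.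
rewrite size_mulX; last by rewrite mulf_neq0 // expf_neq0.
rewrite size_Cmul ?polyX_eq0 // !expr2 !size_mul //.
have := u0; have := v0; rewrite -!size_poly_gt0.
case: (size u) (size v) => [|m] // [|n] // _ _.
by rewrite !addSn !addnS /= !oddD !addbb.
Qed.

Definition red2 : {poly {poly int}} -> {poly {poly 'F_2}} :=
  map_poly (map_poly intr).
HB.instance Definition _ :=
  GRing.RMorphism.copy red2 (map_poly (map_poly (intr : int -> 'F_2))).

Lemma red2X : red2 'X = 'X.
Proof. exact: map_polyX. Qed.

Lemma red2Y : red2 'Y = 'Y.
Proof. by rewrite /red2 map_polyC /= map_polyX. Qed.

Lemma intr_F2_eq0 (n : int) : (n%:~R : 'F_2) = 0 -> (2 %| n)%Z.
Proof.
by rewrite (dvdz_pcharf (pchar_Fp (isT : prime 2))) => /eqP.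
Qed.

(** Coefficientwise divisibility by 2 lifts to polynomials; the ring [A] is
    general because both Z and Z[z] are needed. *)
Lemma poly_halve (A : nzRingType) (dbl : A -> Prop)
    (half : forall a, dbl a -> exists c, a = 2 * c) (p : {poly A}) :
  (forall i, dbl p`_i) -> exists q, p = 2 * q.
Proof.
elim/poly_ind: p => [|p c IH] hp; first by exists 0; rewrite mulr0.
have [i|q ->] := IH.
  by have := hp i.+1; rewrite coefD coefMX coefC addr0.
have [|d ->] := half c.
  by have := hp 0; rewrite coefD coefMX coefC add0r.
by exists (q * 'X + d%:P); rewrite mulrDr mulrA polyCM polyC_natr.
Qed.

Lemma red2_eq0 (p : {poly {poly int}}) :
  red2 p = 0 -> exists q, p = 2 * q.
Proof.
move=> hp.
apply: (@poly_halve _ (fun c => map_poly (intr : int -> 'F_2) c = 0)) => [c hc|i].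
  apply: (@poly_halve _ (fun n => (2 %| n)%Z)) => [n /dvdzP[m ->]|i].
    by exists m; rewrite mulrC.
  apply: intr_F2_eq0.
  by have := congr1 (fun f : {poly 'F_2} => f`_i) hc; rewrite coef_map coef0.
have := congr1 (fun f : {poly {poly 'F_2}} => f`_i) hp.
by rewrite coef_map coef0.
Qed.

(** Modulo 2 the hypothesis is [(r + xp + zt)^2 = xz (t + w)^2], as
    [r^2 = x^2 p^2 + xz w^2 + z^2 t^2 + xz t^2] there and squaring is additive. *)
Lemma norm_eq_parity (r p t w : {poly {poly int}}) :
  r ^+ 2 = 4 + ('X + 4) * ('X * p ^+ 2 + 2 * 'Y * w * p + 'Y * w ^+ 2)
    + 'Y * ('Y - 'X) * t ^+ 2 ->
  exists a b, r = 'X * p + 'Y * t + 2 * a /\ w = t + 2 * b.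
Proof.
move=> E.
have red2_double q : red2 (2 * q) = 0.
  by rewrite rmorphM rmorph_nat -!polyC_natr pchar_Zp // mul0r.
(* Half of [(r + xp + zt)^2 - xz (t + w)^2], after [r^2] is eliminated by [E]. *)
have := red2_double (2 + 2 * ('X * p ^+ 2 + 2 * 'Y * w * p + 'Y * w ^+ 2)
  + ('X * p) ^+ 2 + 'X * 'Y * w * p - 'X * 'Y * t ^+ 2 + 'Y ^+ 2 * t ^+ 2
  - 'X * 'Y * t * w + r * 'X * p + r * 'Y * t + 'X * p * 'Y * t).
set d := 2 * _.
have -> : d = (r + 'X * p + 'Y * t) ^+ 2 - 'X * 'Y * (t + w) ^+ 2.
  by rewrite /d; ring: E.
rewrite rmorphB rmorphXn !rmorphM -expr2 /= red2X red2Y => /subr0_eq.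
move/sqr_eq_XYsqr=> [/red2_eq0[a ha] /red2_eq0[b hb]].
exists (a - 'X * p - 'Y * t), (b - t); split.
  by rewrite !mulrBr -ha; ring.
by rewrite mulrBr -hb; ring.
Qed.

(** * The group of norm 1 elements *)

Section IntegralElements.
Local Notation "p %:F" := (tofrac p) : ring_scope.
Variable R : realType.

Definition lift : {poly {poly int}} -> {poly {poly R}} :=
  map_poly (map_poly intr).
HB.instance Definition _ :=
  GRing.RMorphism.copy lift (map_poly (map_poly (intr : int -> R))).

Definition emb : {poly {poly int}} -> ratfun R := fun p => (lift p)%:F.
HB.instance Definition _ := GRing.RMorphism.copy emb (@tofrac _ \o lift).

Lemma lift_inj : injective lift.
Proof.
apply: map_inj_poly; last exact: rmorph0.
by apply: map_inj_poly => //; exact: intr_inj.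
Qed.

Lemma emb_inj : injective emb.
Proof. by move=> p q /eqP; rewrite tofrac_eq => /eqP /lift_inj. Qed.

Lemma liftY : lift 'Y = 'Y.
Proof. by rewrite /lift map_polyC /= map_polyX. Qed.

Lemma embX : emb 'X = X R.
Proof. by rewrite /emb /lift map_polyX. Qed.

Lemma embY : emb 'Y = Z R.
Proof. by rewrite /emb liftY. Qed.

Lemma X_neq0 : X R != 0.
Proof. by rewrite tofrac_eq0 polyX_eq0. Qed.

Lemma lift00 p : (lift p).[0, 0] = (p.[0, 0])%:~R.
Proof. by rewrite !polyC0 !horner_coef0 !coef_map. Qed.

(** Divisibility by [x] descends from R[x,z] to Z[x,z], since it only says that
    the constant coefficient in [x] vanishes. *)
Lemma X_dvd_lift (s : {poly {poly int}}) (p : {poly {poly R}}) :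
  lift s = 'X * p -> exists q, s = 'X * q.
Proof.
elim/poly_ind: s => [|s c _] h; first by exists 0; rewrite mulr0.
exists s; suff -> : c = 0 by rewrite addr0 mulrC.
apply: (map_inj_poly (@intr_inj R)) => //; rewrite rmorph0.
have := congr1 (fun p : {poly {poly R}} => p`_0) h.
by rewrite coef_map coefXM coefD coefMX coefC add0r.
Qed.

(** From left to right this is [norm_eq_parity].  The condition on [A] is
    [r(0,0) = 1], because the real part [(x P + z T) / 2 + A] takes the value
    [A(0,0)] at the origin. *)
Lemma V0P (q : Q0 R) :
  V0 q <-> qnorm q = 1 /\
    exists A P T B : {poly {poly int}},
      q = order_elt (X R) (Z R) (emb A) (emb P) (emb T) (emb B)
      /\ A.[0, 0] = 1.
Proof.
have two0 := ratfun_2_neq0 R.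
split=> [[N1 [r [s [t [w [q_def [ir is_ it iw] r1 [p sp]]]]]]]|].
  split=> //; case: ir is_ it iw => [r' ir] [s' is_] [t' it] [w' iw].
  have [p' p_def] : exists p', s' - 'Y * w' = 'X * p'.
    apply: (@X_dvd_lift _ (2 * p)); rewrite rmorphB rmorphM /=.
    rewrite -[lift s']is_ -[lift w']iw liftY.
    have {}sp : s - 'Y * w = 'X * p.
      apply/eqP; rewrite -tofrac_eq rmorphB !rmorphM /= -sp mulrCA divff.
        by rewrite mulr1.
      exact: X_neq0.
    by rewrite (mulrCA 'X) -sp mulrBr (mulrCA 2).
  have halfE u v : 2 * u = lift v -> u%:F = emb v / 2.
    by rewrite /emb => <-; rewrite rmorphM rmorph_nat mulrC mulKf.
  move: q_def; rewrite quat_basis.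
  rewrite (halfE _ _ ir) (halfE _ _ is_) (halfE _ _ it) (halfE _ _ iw).
  have -> : s' = 'Y * w' + 'X * p' by rewrite -p_def addrC subrK.
  rewrite rmorphD !rmorphM /= embX embY => q_def.
  have [A [B [rE wE]]] :
      exists a b, r' = 'X * p' + 'Y * t' + 2 * a /\ w' = t' + 2 * b.
    apply: norm_eq_parity; apply: emb_inj.
    rewrite !(rmorph_nat, rmorphXn, rmorphM, rmorphB, rmorphD) /= embX embY.
    have := @qnorm_half _ (X R) (Z R) X_neq0 two0
      (emb r') (emb p') (emb t') (emb w').
    by rewrite -q_def N1 mulr1.
  exists A, p', t', B; split.
    rewrite q_def rE wE /order_elt.
    by rewrite !(rmorph_nat, rmorphD, rmorphM) /= embX embY.
  have : (lift r').[0, 0] = 2 by rewrite -[lift r']ir !hornerE r1 mulr1.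
  rewrite lift00 rE => /(@intr_inj R (_.[0, 0]) 2).
  by rewrite !hornerE => h; apply: (@mulfI _ (2 : int)) => //; rewrite mulr1.
move=> [N1 [A [P [T [B [q_def A1]]]]]]; split=> //.
pose h : {poly {poly R}} := (2^-1)%:P%:P.
have two_h : 2 * h = 1.
  by rewrite -!polyC_natr -!polyCM divff // pnatr_eq0.
have int_half u : int_coef (2 * (h * lift u)).
  by exists u; rewrite mulrA two_h mul1r.
have emb_half u : (h * lift u)%:F = emb u / 2.
  apply: (mulfI two0); rewrite [RHS]mulrC divfK // -(rmorph_nat (@tofrac _)).
  by rewrite -rmorphM /= mulrA two_h mul1r.
exists (h * lift ('X * P + 'Y * T + 2 * A)).
exists (h * lift ('Y * (T + 2 * B) + 'X * P)), (h * lift T).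
exists (h * lift (T + 2 * B)); split=> //.
- rewrite quat_basis !emb_half q_def /order_elt.
  by rewrite !(rmorph_nat, rmorphD, rmorphM) /= embX embY.
- rewrite !hornerE lift00 !hornerE A1 mulr1.
  by rewrite mulVf // pnatr_eq0.
exists (h * lift P).
rewrite !emb_half rmorphD !rmorphM /= embX embY.
exact: half_congr X_neq0 two0 _ _.
Qed.

Lemma V0_1 : V0 (1 : Q0 R).
Proof.
apply/V0P; split.
  by rewrite /qnorm /= !expr0n /= !mulr0 !subr0 addr0 expr1n.
exists 1, 0, 0, 0; split; last by rewrite !hornerE.
rewrite /order_elt rmorph1 rmorph0 !(mulr0, mulr1, add0r, addr0, mul0r).
by rewrite divff // ratfun_2_neq0.
Qed.

Lemma V0_mul (p q : Q0 R) : V0 p -> V0 q -> V0 (p * q).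
Proof.
move=> /V0P[Np [A [P [T [B [pE A1]]]]]] /V0P[Nq [A' [P' [T' [B' [qE A1']]]]]].
apply/V0P; split; first by rewrite qnormM Np Nq mulr1.
have := @order_mul _ (X R) (Z R) X_neq0 (ratfun_2_neq0 R)
  (emb A) (emb P) (emb T) (emb B) (emb A') (emb P') (emb T') (emb B').
have [] := rmorph_mulcoords emb 'X 'Y A P T B A' P' T' B'.
rewrite /= embX embY => <- <- <- <- pqE.
do 4 eexists; split; first by rewrite pE qE; exact: pqE.
by rewrite /coordA_mul !hornerE A1 A1'.
Qed.

Lemma V0_conj (q : Q0 R) : V0 q -> V0 (qconj q).
Proof.
move=> /V0P[Nq [A [P [T [B [qE A1]]]]]].
apply/V0P; split; first by rewrite qnorm_conj.
exists (A + 'X * P + 'Y * T), (- P), (- T), (- B); split.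
  rewrite qE order_conj ?ratfun_2_neq0 //.
  by rewrite !(rmorphN, rmorphD, rmorphM) /= embX embY.
by rewrite !hornerE A1.
Qed.

End IntegralElements.

Theorem theorem7p1 (R : realType) :
  let x := X R in
  let z := Z R in
  let i : Q0 R := quat_i (a0 R) (b0 R) in
  let j : Q0 R := quat_j (a0 R) (b0 R) in
  let k : Q0 R := quat_k (a0 R) (b0 R) in
  [/\ is_mul_group (@V0 R),
      exists2 q : Q0 R, V0 q & q <> 1
    & [/\ V0 (2^-1 *: ((x + 2)%:A + x *: i)),
          V0 (2^-1 *: ((x + 2)%:A + (x - 2 * z) *: i - 2 *: k))
        & V0 (2^-1 *: ((z + 2)%:A - z *: i - j - k))]].
Proof.
have X0 := X_neq0 R; have two0 := ratfun_2_neq0 R.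
have V1 : @V0 R (order_elt (X R) (Z R) 1 1 0 0).
  apply/V0P; split; first exact: qnorm_example1 X0 two0.
  by exists 1, 1, 0, 0; rewrite rmorph1 rmorph0 !hornerE.
move=> x z i j k; split.
- split; [exact: V0_1 | exact: V0_mul | move=> q Vq].
  have [Nq _] := (V0P q).1 Vq.
  exists (qconj q); first exact: V0_conj.
  by split; [rewrite mul_qconj|rewrite mul_conjq]; rewrite Nq scale1r.
- by exists (order_elt (X R) (Z R) 1 1 0 0); [|exact: example1_neq1 X0 two0].
split.
- by rewrite [_ *: _](@example1 _ (X R) (Z R) two0).
- rewrite [_ *: _](@example2 _ (X R) (Z R) two0).
  apply/V0P; split; first exact: qnorm_example2 X0 two0.
  by exists 1, 1, 0, (-1); rewrite rmorphN /= rmorph1 rmorph0 !hornerE.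
rewrite [_ *: _](@example3 _ (X R) (Z R) two0).
apply/V0P; split; first exact: qnorm_example3 X0 two0.
exists (1 + 'Y), 0, (-1), 0.
by rewrite rmorphN rmorphD /= rmorph1 rmorph0 embY !hornerE.
Qed.
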